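(* Let $f:\mathbb{R}^n\to\mathbb{R}^n$ be locally Lipschitz and such that the system $\frac{d}{dt}x(t)=f(x(t))$, $x(0)\in\mathbb{R}^n$, is forward complete. (i) If the system is $\mathcal{L}_2$-stable, then it is $\alpha$-integrable. (ii) Conversely, if the system is $\alpha$-integrable, then there exists a change of coordinates $T:\mathbb{R}^n\to\mathbb{R}^n$ for the state such that the system in the new coordinates is $\mathcal{L}_2$-stable; that is, there exists $\tilde\beta\in\mathcal{K}_\infty$ such that $$\|T(x)\|_{\mathcal{L}_2[0,t]}^2\le\tilde\beta(|T(x(0))|)\quad\text{for all } x(0)\in\mathbb{R}^n,\ t\in\mathbb{R}_{\ge0},$$ where $T(x)$ denotes the function $\tau\mapsto T(x(\tau))$.
   Context: Forward complete means that for every initial condition the solution exists for all $t\ge 0$. $\mathcal{K}_\infty$ is the class of continuous, strictly increasing, unbounded functions $\alpha:\mathbb{R}_{\ge0}\to\mathbb{R}_{\ge0}$ with $\alpha(0)=0$. $|\cdot|$ is the Euclidean norm. For a measurable, locally essentially bounded $y:\mathbb{R}_{\ge0}\to\mathbb{R}^p$, $\|y\|_{\mathcal{L}_2[0,t]}^2:=\int_0^t|y(\tau)|^2d\tau$. The system is $\alpha$-integrable if there exist $\alpha,\beta\in\mathcal{K}_\infty$ such that $\int_0^t\alpha(|x(\tau)|)\,d\tau\le\beta(|x(0)|)$ for all $x(0)\in\mathbb{R}^n$ and $t\ge0$. The system is $\mathcal{L}_2$-stable if there exists $\beta\in\mathcal{K}_\infty$ such that $\|x\|_{\mathcal{L}_2[0,t]}^2\le\beta(|x(0)|)$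 for all $x(0)\in\mathbb{R}^n$ and $t\ge0$. A change of coordinates is a homeomorphism $T:\mathbb{R}^p\to\mathbb{R}^p$ with $T(0)=0$ (differentiability is not required). *)

(* Defs.v *)
From HB Require Import structures.
From mathcomp Require Export all_boot all_order all_algebra.
From mathcomp Require Export all_classical all_reals all_analysis.

Set Implicit Arguments.
Unset Strict Implicit.
Unset Printing Implicit Defensive.

Import Order.TTheory GRing.Theory Num.Theory.
Import numFieldNormedType.Exports.

Local Open Scope classical_set_scope.
Local Open Scope ring_scope.

(* The canonical norm [`|x|] on matrices is the max norm, hence this separate
   Euclidean norm. *)
Definition enorm (R : realType) (n : nat) (x : 'cV[R]_n) : R :=
  Num.sqrt (\sum_(i < n) x i ord0 ^+ 2).

(* Class K_oo is represented by total functions R -> R of which only the values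
   on [0, +oo[ matter; these are nonnegative by the first and third clauses. *)
Definition Kinfty (R : realType) (a : R -> R) : Prop :=
  [/\ a 0 = 0,
      {within `[0, +oo[%classic, continuous a},
      (forall r s : R, 0 <= r -> r < s -> a r < a s) &
      (forall M : R, exists2 r : R, 0 <= r & M < a r)].

Definition locally_lipschitz (R : realType) (n : nat)
    (f : 'cV[R]_n -> 'cV[R]_n) : Prop :=
  forall x : 'cV[R]_n, exists L r : R, 0 < r /\
    forall y z : 'cV[R]_n, enorm (y - x) < r -> enorm (z - x) < r ->
      enorm (f y - f z) <= L * enorm (y - z).

(* [x] solves x' = f(x) on [0, +oo[: the difference quotient is restricted to
   nonnegative times, so the derivative is two-sided at t > 0 and one-sided at
   t = 0. Values of [x] at negative times are irrelevant. *)
Definition solution (R : realType) (n : nat)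
    (f : 'cV[R]_n -> 'cV[R]_n) (x : R -> 'cV[R]_n) : Prop :=
  forall t : R, 0 <= t ->
    ((s - t)^-1 *: (x s - x t) @[s --> within [set s : R | 0 <= s] t^'])
      --> f (x t).

Definition forward_complete (R : realType) (n : nat)
    (f : 'cV[R]_n -> 'cV[R]_n) : Prop :=
  forall x0 : 'cV[R]_n, exists2 x : R -> 'cV[R]_n, solution f x & x 0 = x0.

Definition alpha_integrable (R : realType) (n : nat)
    (f : 'cV[R]_n -> 'cV[R]_n) : Prop :=
  exists alpha beta : R -> R, [/\ Kinfty alpha, Kinfty beta &
    forall x : R -> 'cV[R]_n, solution f x -> forall t : R, 0 <= t ->
      (\int[lebesgue_measure]_(tau in `[0%R, t]) (alpha (enorm (x tau)))%:E
         <= (beta (enorm (x 0%R)))%:E)%E].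

Definition L2normsq (R : realType) (p : nat) (y : R -> 'cV[R]_p) (t : R) :
    \bar R :=
  (\int[lebesgue_measure]_(tau in `[0%R, t]) ((enorm (y tau)) ^+ 2)%:E)%E.

Definition L2_stable (R : realType) (n : nat)
    (f : 'cV[R]_n -> 'cV[R]_n) : Prop :=
  exists2 beta : R -> R, Kinfty beta &
    forall x : R -> 'cV[R]_n, solution f x -> forall t : R, 0 <= t ->
      (L2normsq x t <= (beta (enorm (x 0%R)))%:E)%E.

Definition change_of_coordinates (R : realType) (p : nat)
    (T : 'cV[R]_p -> 'cV[R]_p) : Prop :=
  T 0 = 0 /\
  exists S : 'cV[R]_p -> 'cV[R]_p,
    [/\ cancel T S, cancel S T, continuous T & continuous S].

(* Main.v *)
(** The radial map [T x = (g |x| / |x|) x] with [g = sqrt o alpha] is a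
    homeomorphism, with inverse the radial map of [g^-1], and
    [|T x|^2 = alpha |x|].  Hence the L2 bound in the new coordinates is the
    alpha-integral bound, with [beta o g^-1] as comparison function.  For the
    converse direction take [alpha r = r^2]. *)
Require Import Defs.
Set Implicit Arguments.
Unset Strict Implicit.
Unset Printing Implicit Defensive.
Import Order.TTheory GRing.Theory Num.Theory.
Import numFieldNormedType.Exports.
Local Open Scope classical_set_scope.
Local Open Scope ring_scope.

(** * Closure of [Kinfty] under inversion and composition, with square and square root as
    instances *)

Section KinftyTheory.
Context {R : realType}.
Implicit Types a b g h : R -> R.

Lemma Kinfty_ge0 a r : Kinfty a -> 0 <= r -> 0 <= a r.
Proof.
move=> [a0 _ ai _]; rewrite le_eqVlt => /predU1P[<-|r0]; first by rewrite a0.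
by apply: ltW; rewrite -a0; exact: ai.
Qed.

Lemma Kinfty_cvg a (r : R) : Kinfty a -> 0 <= r ->
  a s @[s --> within `[0, +oo[ (nbhs r)] --> a r.
Proof.
move=> [_ ac _ _] r0; move/subspace_continuousP : ac; apply.
by rewrite /= in_itv /= r0.
Qed.

Lemma lt_of_incr h r s : (forall r s, 0 <= r -> r < s -> h r < h s) ->
  0 <= s -> h r < h s -> r < s.
Proof.
move=> hi s0 hrs; rewrite ltNge le_eqVlt; apply/negP => /predU1P[srE|sr].
  by rewrite srE ltxx in hrs.
by have := lt_trans hrs (hi _ _ s0 sr); rewrite ltxx.
Qed.

(** Unboundedness gives [M] with [s < a M], and the intermediate value theorem applies on
    [[0, M]]. *)
Lemma Kinfty_surj a s : Kinfty a -> 0 <= s -> exists2 r, 0 <= r & a r = s.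
Proof.
move=> Ka s0; have [a0 ac _ au] := Ka.
have [M M0 sM] := au s.
have acM : {within `[0, M], continuous a}.
  apply: continuous_subspaceW ac => x /=.
  by rewrite !in_itv /= => /andP[->].
have [|r] := IVT M0 acM (v := s).
  by rewrite a0 minEle maxEle (Kinfty_ge0 Ka M0) s0 ltW.
by rewrite in_itv /= => /andP[r0 _] <-; exists r.
Qed.

(** An increasing surjection has no jumps: preimages of [h r - e] and [h r + e] bracket a
    neighbourhood of [r]. Inverses, compositions and roots thus enter [Kinfty] without a separate
    continuity argument. *)
Lemma surj_Kinfty h : h 0 = 0 ->
  (forall r s, 0 <= r -> r < s -> h r < h s) ->
  (forall s, 0 <= s -> exists2 r, 0 <= r & h r = s) -> Kinfty h.
Proof.
move=> h0 hi hs.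
have hge0 r : 0 <= r -> 0 <= h r.
  rewrite le_eqVlt => /predU1P[<-|r0]; first by rewrite h0.
  by apply: ltW; rewrite -h0; exact: hi.
split => // [|M].
- apply/subspace_continuousP => r; rewrite /= in_itv /= andbT => r0.
  apply/cvgrPdist_lt => e e0; rewrite near_withinE.
  have [u u0 hu] : exists2 u, 0 <= u & h u = h r + e.
    by apply: hs; rewrite addr_ge0 ?hge0// ltW.
  have ru : r < u by apply: (lt_of_incr hi) => //; rewrite hu ltrDl.
  have [l lr hl] : exists2 l, l < r & forall s, 0 <= s -> l < s -> h r - e < h s.
    (* When [h r < e] the value [h r - e] is negative and has no preimage to use, but then any
       [l < r] works because [h] is nonnegative on [[0, +oo[]. *)
    have [re|er] := ltP (h r) e.
      exists (r - 1) => [|s s0 _]; first by rewrite gtrBl.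
      by rewrite (lt_le_trans _ (hge0 _ s0))// subr_lt0.
    have [l l0 hl] : exists2 l, 0 <= l & h l = h r - e.
      by apply: hs; rewrite subr_ge0.
    exists l => [|s s0 ls]; last by rewrite -hl; exact: hi.
    by apply: (lt_of_incr hi) => //; rewrite hl gtrBl.
  have : \forall s \near r, s \in `]l, u[.
    by apply: near_in_itvoo; rewrite in_itv /= lr ru.
  apply: filterS => s; rewrite /= !in_itv /= andbT => /andP[ls su] s0.
  by rewrite ltr_distlC hl//= -hu; exact: hi.
- have [r r0 hr] : exists2 r, 0 <= r & h r = `|M| + 1 by apply: hs.
  by exists r => //; rewrite hr (le_lt_trans (ler_norm M))// ltrDl.
Qed.

(** The inverse on [[0, +oo[] inherits monotonicity and surjectivity from [g], and [surj_Kinfty]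
    then supplies its continuity. *)
Lemma Kinfty_inv g : Kinfty g ->
  exists h, [/\ Kinfty h, (forall r, 0 <= r -> h (g r) = r)
                & (forall s, 0 <= s -> g (h s) = s)].
Proof.
move=> Kg; have [g0 _ gi _] := Kg.
have ginj r s : 0 <= r -> 0 <= s -> g r = g s -> r = s.
  move=> r0 s0 grs; apply/eqP; rewrite eq_le !leNgt; apply/andP; split.
    by apply/negP => /(gi _ _ s0); rewrite grs ltxx.
  by apply/negP => /(gi _ _ r0); rewrite grs ltxx.
(* The sign condition sits under the existential so that choice yields a total function; its values
   at negative [s] are arbitrary. *)
have /choice[h hP] s : exists r, 0 <= s -> 0 <= r /\ g r = s.
  have [s0|_] := leP 0 s; last by exists 0.
  by have [r r0 gr] := Kinfty_surj Kg s0; exists r.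
have h_ge0 s : 0 <= s -> 0 <= h s by move=> /hP[].
have gK s : 0 <= s -> g (h s) = s by move=> /hP[].
have hK r : 0 <= r -> h (g r) = r.
  by move=> r0; have /hP[? ?] := Kinfty_ge0 Kg r0; exact: ginj.
exists h; split=> //; apply: surj_Kinfty => [|r s r0 rs|s s0].
- by rewrite -{1}g0 hK.
- have s0 := le_trans r0 (ltW rs).
  by apply: (lt_of_incr gi); rewrite ?h_ge0// !gK.
- by exists (g s); rewrite ?hK// Kinfty_ge0.
Qed.

Lemma Kinfty_comp a b : Kinfty a -> Kinfty b -> Kinfty (a \o b).
Proof.
move=> Ka Kb; have [a0 _ ai _] := Ka; have [b0 _ bi _] := Kb.
apply: surj_Kinfty => [|r s r0 rs|s s0] /=; first by rewrite b0.
- by apply: ai; rewrite ?bi// (Kinfty_ge0 Kb).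
- have [t t0 <-] := Kinfty_surj Ka s0.
  by have [r r0 <-] := Kinfty_surj Kb t0; exists r.
Qed.

Lemma Kinfty_sqr : Kinfty (fun r : R => r ^+ 2).
Proof.
apply: surj_Kinfty => [|r s r0 rs|s s0]; first by rewrite expr0n.
- by rewrite ltrXn2r// nnegrE// ltW// (le_lt_trans r0).
- by exists (Num.sqrt s); rewrite ?sqrtr_ge0 ?sqr_sqrtr.
Qed.

Lemma Kinfty_sqrt : Kinfty (@Num.sqrt R).
Proof.
apply: surj_Kinfty => [|r s r0 rs|s s0]; first by rewrite sqrtr0.
- by rewrite ltr_sqrt// (le_lt_trans r0).
- by exists (s ^+ 2); rewrite ?sqr_ge0// sqrtr_sqr ger0_norm.
Qed.

End KinftyTheory.

(** * Euclidean norm and radial homeomorphisms *)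

Section RadialMap.
Context {R : realType} {n : nat}.
Implicit Types (x : 'cV[R]_n) (g h : R -> R).

Lemma enorm_ge0 x : 0 <= enorm x.
Proof. exact: sqrtr_ge0. Qed.

Lemma enorm0 : enorm (0 : 'cV[R]_n) = 0.
Proof. by rewrite /enorm big1 ?sqrtr0// => i _; rewrite mxE expr0n. Qed.

Lemma enormZ (c : R) x : enorm (c *: x) = `|c| * enorm x.
Proof.
rewrite /enorm -sqrtr_sqr -sqrtrM ?sqr_ge0// mulr_sumr; congr Num.sqrt.
by apply: eq_bigr => i _; rewrite mxE exprMn.
Qed.

(** The topology on column vectors comes from the max norm; this bound transfers Euclidean estimates
    to it. *)
Lemma norm_le_enorm x : `|x| <= enorm x.
Proof.
rewrite [leLHS]mx_normrE; apply/bigmax_leP; split=> [|[i j] _ /=].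
  exact: enorm_ge0.
rewrite (ord1 j) -sqrtr_sqr ler_wsqrtr// (bigD1 i)//= lerDl.
by apply: sumr_ge0 => k _; exact: sqr_ge0.
Qed.

Lemma enorm_eq0 x : enorm x = 0 -> x = 0.
Proof.
by move=> x0; apply/eqP; rewrite -normr_le0 -x0 norm_le_enorm.
Qed.

Lemma enorm_continuous : continuous (@enorm R n).
Proof.
move=> x; apply: continuous_comp; last exact: sqrt_continuous.
apply: continuous_big => [|i _ y]; first exact: add_continuous.
apply: (@continuous_comp _ _ _ (fun z : 'cV[R]_n => z i ord0)
  (fun r : R => r ^+ 2)); last exact: exprn_continuous.
exact: coord_continuous.
Qed.

Lemma Kinfty_enorm_continuous g : Kinfty g -> continuous (g \o @enorm R n).
Proof.
(* [g] is only continuous within [[0, +oo[], so the limit passes through that restricted filter,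
   where [enorm] takes its values. *)
move=> Kg x; apply: (@cvg_comp _ _ _ (@enorm R n) g (nbhs x)
  (within `[0, +oo[ (nbhs (enorm x)))); last exact: Kinfty_cvg (enorm_ge0 x).
move=> A /= /(@enorm_continuous x _) xA.
by apply: (@filterS _ (nbhs x) _ _ _ _ xA) => y; apply; rewrite /= in_itv /= enorm_ge0.
Qed.

(* At [x = 0] the quotient is [0] since [0^-1 = 0]. *)
Definition radial g x : 'cV[R]_n := (g (enorm x) / enorm x) *: x.

Lemma radial0 g : radial g 0 = 0.
Proof. exact: scaler0. Qed.

Lemma enorm_radial g x : Kinfty g -> enorm (radial g x) = g (enorm x).
Proof.
move=> Kg; have [x0|x0] := eqVneq (enorm x) 0.
  by rewrite (enorm_eq0 x0) radial0 enorm0; case: Kg => ->.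
by rewrite /radial enormZ ger0_norm ?divfK// divr_ge0 ?(Kinfty_ge0 Kg) ?enorm_ge0.
Qed.

Lemma radialK g h : Kinfty g -> (forall r, 0 <= r -> h (g r) = r) ->
  cancel (radial g) (radial h).
Proof.
move=> Kg hK x; rewrite {1}/radial enorm_radial// hK ?enorm_ge0//.
rewrite /radial scalerA.
have [x0|x0] := eqVneq (enorm x) 0; first by rewrite (enorm_eq0 x0) !scaler0.
(* The two scaling factors are [g r / r] and [r / g r] with [r = enorm x]; they cancel once [g r] is
   nonzero. *)
have gx0 : g (enorm x) != 0.
  have [g0 _ gi _] := Kg.
  by rewrite gt_eqF// -g0 gi// lt_def x0 enorm_ge0.
by rewrite mulrA divfK// divff// scale1r.
Qed.

Lemma radial_continuous g : Kinfty g -> continuous (radial g).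
Proof.
move=> Kg x; have gc := Kinfty_enorm_continuous Kg.
(* The factor [g r / r] may be unbounded near [0], so continuity there comes from the bound of the
   max norm of [radial g y] by [g (enorm y)], which tends to [0]. Elsewhere the factor is a
   continuous quotient. *)
have [->|x0] := eqVneq x 0.
  rewrite /continuous_at radial0.
  apply/(@cvgr0Pnorm_lt _ _ _ (nbhs (0 : 'cV[R]_n))) => e e0.
  have : g (enorm y) @[y --> (0 : 'cV[R]_n)] --> 0.
    by have := gc 0; rewrite /continuous_at/= enorm0; case: Kg => ->.
  move/cvgr0Pnorm_lt => /(_ _ e0) gy.
  apply: (@filterS _ (nbhs (0 : 'cV[R]_n)) _ _ _ _ gy) => y.
  rewrite -enorm_radial// ger0_norm ?enorm_ge0//.
  exact/le_lt_trans/norm_le_enorm.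
apply: (@continuousZ _ _ _ (fun y : 'cV[R]_n => g (enorm y) / enorm y) id);
  last exact: cvg_id.
apply: (@continuousM _ _ (g \o @enorm R n) (fun y => (enorm y)^-1)).
  exact: gc.
apply: continuousV; last exact: enorm_continuous.
by apply: contra_neq x0; exact: enorm_eq0.
Qed.

Lemma radial_change_of_coordinates g h : Kinfty g -> Kinfty h ->
  (forall r, 0 <= r -> h (g r) = r) -> (forall s, 0 <= s -> g (h s) = s) ->
  change_of_coordinates (radial g).
Proof.
move=> Kg Kh hK gK; split; first exact: radial0.
by exists (radial h); split; by [exact: radialK|exact: radial_continuous].
Qed.

End RadialMap.

Theorem theorem1 (R : realType) (n : nat) (f : 'cV[R]_n -> 'cV[R]_n)
    (f_lip : locally_lipschitz f) (f_fc : forward_complete f) :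
  (L2_stable f -> alpha_integrable f) /\
  (alpha_integrable f ->
   exists2 T : 'cV[R]_n -> 'cV[R]_n, change_of_coordinates T &
     exists2 betat : R -> R, Kinfty betat &
       forall x : R -> 'cV[R]_n, solution f x -> forall t : R, 0 <= t ->
         (L2normsq (T \o x) t <= (betat (enorm (T (x 0%R))))%:E)%E).
Proof.
split=> [[beta Kbeta fbeta]|[alpha [beta [Kalpha Kbeta fbeta]]]].
  (* With this [alpha] the two integral bounds coincide by unfolding [L2normsq]. *)
  by exists (fun r => r ^+ 2), beta; split=> //; exact: Kinfty_sqr.
have Kg := Kinfty_comp Kinfty_sqrt Kalpha.
have [h [Kh hK gK]] := Kinfty_inv Kg.
exists (radial (Num.sqrt \o alpha)).
  exact: radial_change_of_coordinates Kg Kh hK gK.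
exists (beta \o h); first exact: Kinfty_comp.
(* On the right, [h] cancels [g] at the initial state, leaving [beta (enorm (x 0))]. *)
move=> x xf t t0; rewrite enorm_radial// [X in X%:E]/= hK ?enorm_ge0//.
apply: le_trans (fbeta x xf t t0).
(* Squaring undoes the root since [alpha] is nonnegative at [enorm (x tau)], so the integrands agree
   pointwise. *)
rewrite /L2normsq; under eq_integral => tau _.
  rewrite [X in X%:E](_ : _ = alpha (enorm (x tau))); last first.
    by rewrite /= enorm_radial//= sqr_sqrtr// Kinfty_ge0 ?enorm_ge0.
  over.
exact: lexx.
Qed.
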